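(* Let $u(t)$, $t\ge 0$, be the solution to the constrained gradient flow $$\dot u(t) = -\nabla^2\Phi(u(t))^{-1}\big(\nabla f(u(t)) + A^\top c(u(t))\big),\qquad u(0)=u_0,$$ where $c(u)\in\mathbb R^m$ is the multiplier for which the constraint $Au(t)=b$ holds for all $t\ge 0$. Then for every $T>0$, $$ f\left(\frac1T\int_0^T u(t)\,dt\right) - f(u^* ) \le \frac1T D_\Phi(u^*,u_0).$$
   Context: Setting: $\Omega\subset\mathbb R^n$ is convex, $f:\Omega\to\mathbb R$ is a convex differentiable function, $A\in\mathbb R^{m\times n}$, $b\in\mathbb R^m$ ($m\ge 0$; $m=0$ means no constraint). The problem $\min_{u\in\Omega:\,Au=b} f(u)$ is assumed to have a unique solution $u^*$. $\Phi:\Omega\to\mathbb R$ is twice differentiable and 1-strongly convex with respect to a given norm $\|\cdot\|_w$, i.e. $D_\Phi(x,y)\ge\frac12\|x-y\|_w^2$, where $$D_\Phi(x,y)=\Phi(x)-\Phi(y)-\nabla\Phi(y)^\top(x-y)$$ is the Bregman divergence induced by $\Phi$. The initial point $u_0\in\Omega$ satisfies $Au_0=b$ and the trajectory stays in $\Omega$. *)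

(* Defs.v *)
From mathcomp Require Export all_boot all_order all_algebra.
From mathcomp Require Export all_classical all_reals all_analysis.

Set Implicit Arguments.
Unset Strict Implicit.
Unset Printing Implicit Defensive.

Import Order.TTheory GRing.Theory Num.Theory.
Import numFieldNormedType.Exports.

Local Open Scope classical_set_scope.
Local Open Scope ring_scope.

(* First-order expansion of f at x along D.  At interior points of D this is
   ordinary Frechet differentiability with differential L; at boundary points
   it is the one-sided notion, which only involves the values of f on D. *)
Definition is_diff_within (R : realType) (V W : normedModType R)
    (D : set V) (f : V -> W) (x : V) (L : V -> W) : Prop :=
  forall eps : R, 0 < eps ->
    \forall y \near within D (nbhs x),
      `|f y - f x - L (y - x)| <= eps * `|y - x|.

Definition dotv (R : realType) (n : nat) (x y : 'cV[R]_n) : R :=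
  (x^T *m y) 0 0.

Definition is_gradient_on (R : realType) (n : nat) (Omega : set 'cV[R]_n)
    (f : 'cV[R]_n -> R) (gradf : 'cV[R]_n -> 'cV[R]_n) : Prop :=
  forall x, Omega x ->
    is_diff_within Omega (f : _ -> R^o) x (dotv (gradf x) : _ -> R^o).

Definition is_jacobian_on (R : realType) (n : nat) (Omega : set 'cV[R]_n)
    (g : 'cV[R]_n -> 'cV[R]_n) (J : 'cV[R]_n -> 'M[R]_n) : Prop :=
  forall x, Omega x -> is_diff_within Omega g x (mulmx (J x)).

Record is_norm (R : realType) (n : nat) (N : 'cV[R]_n -> R) : Prop := IsNorm {
  is_norm_definite : forall x, N x = 0 -> x = 0;
  is_norm_homogeneous : forall (a : R) x, N (a *: x) = `|a| * N x;
  is_norm_triangle : forall x y, N (x + y) <= N x + N y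
}.

Definition bregman (R : realType) (n : nat) (Phi : 'cV[R]_n -> R)
    (gradPhi : 'cV[R]_n -> 'cV[R]_n) (x y : 'cV[R]_n) : R :=
  Phi x - Phi y - dotv (gradPhi y) (x - y).

Definition strongly_convex1 (R : realType) (n : nat) (Omega : set 'cV[R]_n)
    (normw : 'cV[R]_n -> R) (Phi : 'cV[R]_n -> R)
    (gradPhi : 'cV[R]_n -> 'cV[R]_n) : Prop :=
  forall x y, Omega x -> Omega y ->
    2^-1 * normw (x - y) ^+ 2 <= bregman Phi gradPhi x y.

Definition feasible (R : realType) (m n : nat) (Omega : set 'cV[R]_n)
    (A : 'M[R]_(m, n)) (b : 'cV[R]_m) : set 'cV[R]_n :=
  [set x | Omega x /\ A *m x = b].

Definition argmin (R : realType) (n : nat) (S : set 'cV[R]_n)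
    (f : 'cV[R]_n -> R) : set 'cV[R]_n :=
  [set x | S x /\ forall y, S y -> f x <= f y].

(* The derivative at t = 0 is the right derivative.  [invmx] is the inverse
   only on unit matrices; invertibility is not part of this definition. *)
Definition constrained_gradient_flow (R : realType) (m n : nat)
    (Omega : set 'cV[R]_n) (gradf : 'cV[R]_n -> 'cV[R]_n)
    (hessPhi : 'cV[R]_n -> 'M[R]_n) (A : 'M[R]_(m, n)) (b : 'cV[R]_m)
    (c : 'cV[R]_n -> 'cV[R]_m) (u0 : 'cV[R]_n) (u : R -> 'cV[R]_n) : Prop :=
  [/\ u 0 = u0,
      forall t : R, 0 <= t -> Omega (u t),
      forall t : R, 0 <= t ->
        is_diff_within (`[0, +oo[ : set R^o) (u : R^o -> _) t
          (fun h : R^o =>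
             h *: - (invmx (hessPhi (u t)) *m
                       (gradf (u t) + A^T *m c (u t))))
    & forall t : R, 0 <= t -> A *m u t = b].

Definition time_average (R : realType) (n : nat) (u : R -> 'cV[R]_n) (T : R) :
    'cV[R]_n :=
  \col_i (T^-1 * \int[lebesgue_measure]_(t in `[0, T]) u t i 0).

(* Main.v *)
Require Import Defs.
From mathcomp Require Import ring lra.

(** Let [V t] be the Bregman divergence from [ustar] to [u t].  Along a curve in
    [Omega] its derivative is the pairing of [- (hessPhi (u t) *m u' t)] with
    [ustar - u t] ([derivative_on_bregman]).  On the flow
    [hessPhi (u t) *m u' t] is the opposite of [gradf (u t) + A^T *m c (u t)];
    the multiplier term pairs to zero with [ustar - u t], which lies in the
    kernel of [A], so [V' t = dotv (gradf (u t)) (ustar - u t)], and convexity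
    gives [V' t <= f ustar - f (u t)].

    Write [a] for the time average.  Jensen's inequality is not used as an
    inequality between integrals: the tangent of [f] at [a] yields
    [f a + dotv (gradf a) (u t - a) <= f (u t)], so that
    [W t = V t + (f a - f ustar) * t + dotv (gradf a) (displacement u t - t *: a)]
    is nonincreasing, where [displacement u] is the antiderivative of [u].  The
    last term vanishes at [0] and at [T], and [V T >= 0], so [W T <= W 0] is the
    claim multiplied by [T].

    Two points need care because [Omega] is an arbitrary convex set.  The tangent
    at [a] requires [a] to belong to [Omega], though [Omega] may fail to be closed
    or to have interior points; this is [time_average_mem], which rests on the
    proper separation of a point from an arbitrary finite-dimensional convex set
    ([proper_separation]).  Multiplying the flow equation by the Hessian
    requires the Hessian to be invertible; at interior points this follows from
    strong convexity ([strongly_convex1_hessian_unit]). *)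

Set Implicit Arguments.
Unset Strict Implicit.
Unset Printing Implicit Defensive.

Import Order.TTheory GRing.Theory Num.Theory.
Import numFieldNormedType.Exports.

Local Open Scope classical_set_scope.
Local Open Scope ring_scope.

(** * The Euclidean pairing *)

Lemma dotvE (R : realType) (n : nat) (x y : 'cV[R]_n) :
  dotv x y = \sum_i x i 0 * y i 0.
Proof. by rewrite /dotv mxE; apply: eq_bigr => i _; rewrite mxE. Qed.

Lemma dotvC (R : realType) (n : nat) (x y : 'cV[R]_n) : dotv x y = dotv y x.
Proof. by rewrite !dotvE; apply: eq_bigr => i _; rewrite mulrC. Qed.

Lemma dotvBr (R : realType) (n : nat) (p x y : 'cV[R]_n) :
  dotv p (x - y) = dotv p x - dotv p y.
Proof. by rewrite /dotv mulmxBr !mxE. Qed.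

Lemma dotvDr (R : realType) (n : nat) (p x y : 'cV[R]_n) :
  dotv p (x + y) = dotv p x + dotv p y.
Proof. by rewrite /dotv mulmxDr !mxE. Qed.

Lemma dotvZr (R : realType) (n : nat) (p x : 'cV[R]_n) (a : R) :
  dotv p (a *: x) = a * dotv p x.
Proof. by rewrite /dotv -scalemxAr mxE. Qed.

Lemma dotvNr (R : realType) (n : nat) (p x : 'cV[R]_n) :
  dotv p (- x) = - dotv p x.
Proof. by rewrite /dotv mulmxN mxE. Qed.

Lemma dotv0 (R : realType) (n : nat) (p : 'cV[R]_n) : dotv p 0 = 0.
Proof. by rewrite /dotv mulmx0 mxE. Qed.

Lemma dot0v (R : realType) (n : nat) (p : 'cV[R]_n) : dotv 0 p = 0.
Proof. by rewrite dotvC dotv0. Qed.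

Lemma dotv_delta (R : realType) (n : nat) (x : 'cV[R]_n) (i : 'I_n) :
  dotv (delta_mx i 0) x = x i 0.
Proof.
rewrite dotvE (bigD1 i) //= mxE !eqxx mul1r big1 ?addr0 // => j ji.
by rewrite mxE (negbTE ji) mul0r.
Qed.

Lemma dotv_mulmx (R : realType) (m n : nat) (A : 'M[R]_(m, n))
    (x : 'cV[R]_m) (y : 'cV[R]_n) :
  dotv (A^T *m x) y = dotv x (A *m y).
Proof. by rewrite /dotv trmx_mul trmxK mulmxA. Qed.

Lemma entry_le_norm (R : realType) (n : nat) (x : 'cV[R]_n) (i : 'I_n) :
  `|x i 0| <= `|x|.
Proof.
by rewrite [leRHS]/Num.norm /= mx_normrE; apply/bigmax_geP; right => /=; exists (i, 0).
Qed.

Lemma dotv_le (R : realType) (n : nat) (p x : 'cV[R]_n) :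
  `|dotv p x| <= (\sum_i `|p i 0|) * `|x|.
Proof.
rewrite dotvE mulr_suml; apply: le_trans (ler_norm_sum _ _ _) _.
by apply: ler_sum => i _; rewrite normrM ler_wpM2l // entry_le_norm.
Qed.

(** * Differentials relative to a set, composed with curves *)

Lemma is_diff_within_coord (R : realType) (V : normedModType R) (n : nat)
    (D : set V) (g : V -> 'cV[R]_n) (x : V) (L : V -> 'cV[R]_n) (i : 'I_n) :
  is_diff_within D g x L ->
  is_diff_within D ((fun y => g y i 0) : V -> R^o) x
    ((fun v => L v i 0) : V -> R^o).
Proof.
move=> gL e e0; move: (gL e e0); apply: filterS => y.
apply: le_trans.
have -> : g y i 0 - g x i 0 - L (y - x) i 0 = (g y - g x - L (y - x)) i 0.
  by rewrite !mxE.
exact: entry_le_norm.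
Qed.

Lemma is_diff_within_cvg (R : realType) (V : normedModType R) (D : set R^o)
    (g : R^o -> V) (t : R) (v : V) :
  is_diff_within D g t (fun h => h *: v) ->
  g @ within D (nbhs (t : R^o)) --> g t.
Proof.
move=> gv; apply/cvgrPdist_le => e e0.
pose K : R := `|v| + 1.
have K0 : 0 < K by rewrite ltr_wpDl.
have near_t : \forall s \near within D (nbhs (t : R^o)), `|s - t| <= e / K.
  apply: cvg_within; near=> s.
  rewrite distrC.
  by near: s; apply: (@cvgr_dist_le _ R^o); [exact: cvg_id | exact: divr_gt0].
move: (gv 1 ltr01); apply: filterS2 near_t => s st.
rewrite mul1r => gs; rewrite distrC.
have -> : g s - g t = (g s - g t - (s - t) *: v) + (s - t) *: v.
  by rewrite subrK.
apply: le_trans (ler_normD _ _) _; rewrite normrZ.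
apply: le_trans (_ : `|s - t| * K <= _); last by rewrite -ler_pdivlMr.
by rewrite /K mulrDr mulr1 addrC lerD2l.
Unshelve. all: by end_near. Qed.

(** The chain rule holds even where [u t] is a boundary point of [E], because the
    curve never leaves [E] and so only meets points at which the one-sided
    expansion of [f] is available. *)
Lemma is_diff_within_comp_curve (R : realType) (n : nat) (D : set R^o)
    (E : set 'cV[R]_n) (u : R^o -> 'cV[R]_n) (f : 'cV[R]_n -> R) (t : R)
    (p v : 'cV[R]_n) :
  (forall s, D s -> E (u s)) ->
  is_diff_within D u t (fun h => h *: v) ->
  is_diff_within E (f : _ -> R^o) (u t) (dotv p : _ -> R^o) ->
  is_diff_within D (f \o u : R^o -> R^o) t (fun h => h * dotv p v).
Proof.
move=> DE uv fp e e0.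
pose K := \sum_i `|p i 0|.
have K0 : 0 <= K by apply: sumr_ge0.
(* [e1] bounds the error of [u], which the differential of [f] amplifies by at
   most [K]; [e2] bounds the error of [f], proportional to the increment of [u],
   itself at most [(`|v| + 1) * `|s - t|] since [e1 <= 1]. *)
pose e1 := Num.min 1 (e / 2 / (K + 1)).
pose e2 := e / 2 / (`|v| + 1).
have e10 : 0 < e1 by rewrite lt_min ltr01 /= !divr_gt0 // ltr_wpDl.
have e20 : 0 < e2 by rewrite !divr_gt0 // ltr_wpDl.
have uE : u @ within D (nbhs (t : R^o)) --> within E (nbhs (u t)).
  move=> B /= BE; have := is_diff_within_cvg uv BE.
  rewrite /= !nbhs_simpl /=.
  rewrite /within /=; apply: filterS => s sB Ds.
  by apply: sB => //; exact: DE.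
have := uE _ (fp _ e20); rewrite /= nbhs_simpl /=.
apply: filterS2 (uv _ e10) => s us fs /=.
have {fs} : `|f (u s) - f (u t) - dotv p (u s - u t)| <= e2 * `|u s - u t| by [].
move=> fs.
set d := `|s - t|.
have -> : f (u s) - f (u t) - (s - t) * dotv p v =
  (f (u s) - f (u t) - dotv p (u s - u t)) + dotv p (u s - u t - (s - t) *: v).
  by rewrite [dotv p (_ - _ *: _)]dotvBr dotvZr; ring.
apply: le_trans (ler_normD _ _) _.
have d0 : 0 <= d by exact: normr_ge0.
have usd : `|u s - u t| <= (`|v| + 1) * d.
  have -> : u s - u t = (u s - u t - (s - t) *: v) + (s - t) *: v by rewrite subrK.
  apply: le_trans (ler_normD _ _) _; rewrite normrZ -/d.
  have : e1 * d <= d by rewrite ler_piMl // ge_min lexx.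
  by move: us; rewrite -/d => us ?; lra.
have A1 : e2 * `|u s - u t| <= e / 2 * d.
  apply: le_trans (ler_wpM2l (ltW e20) usd) _.
  by rewrite mulrA /e2 divfK // gt_eqF // ltr_wpDl.
have A2 : `|dotv p (u s - u t - (s - t) *: v)| <= e / 2 * d.
  apply: le_trans (dotv_le _ _) _; rewrite -/K.
  apply: le_trans (_ : (K + 1) * (e1 * d) <= _).
    by apply: ler_pM => //; rewrite lerDl.
  rewrite mulrA ler_wpM2r // mulrC -ler_pdivlMr ?ltr_wpDl //.
  by rewrite ge_min lexx orbT.
have -> : e * d = e / 2 * d + e / 2 * d by rewrite -mulrDl -splitr.
by apply: lerD => //; exact: le_trans fs _.
Qed.

(** At an interior time the relative notion of differentiability is the usual
    one, which gives access to the mean value theorem. *)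
Lemma is_diff_within_is_derive (R : realType) (D : set R^o) (g : R^o -> R^o)
    (t d : R) :
  D^° t -> is_diff_within D g t (fun h => h * d) -> is_derive (t : R^o) 1 g d.
Proof.
move=> tD gd.
have lim : (fun h : R => h^-1 *: (g (h *: (1 : R^o) + t) - g t)) @ 0^' --> (d : R^o).
  apply/cvgrPdist_le => e e0.
  have ge : \forall y \near (t : R^o),
      D y -> `|g y - g t - (y - t) * d| <= e * `|y - t| := gd e e0.
  have : \forall y \near (t : R^o), `|g y - g t - (y - t) * d| <= e * `|y - t|.
    have tD' : \forall y \near (t : R^o), D y := tD.
    by apply: filterS2 tD' ge => y Dy yD; exact: yD.
  move=> {}ge.
  have : (fun h : R => h *: (1 : R^o) + t) @ 0^' --> (t : R^o).
    apply: cvg_within_filter.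
    have h0 : (fun h : R => h *: (1 : R^o) + t) @ 0 --> (0 *: (1 : R^o) + t : R^o).
      by apply: cvgD; [apply: cvgZr_tmp; exact: cvg_id | exact: cvg_cst].
    by move: h0; rewrite scale0r add0r.
  move=> /(_ _ ge); rewrite /= nbhs_simpl /= => {}ge.
  near=> h.
  have h0 : h != 0 by near: h; exact: nbhs_dnbhs_neq.
  have : `|g (h *: (1 : R^o) + t) - g t - (h *: (1 : R^o) + t - t) * d| <=
         e * `|h *: (1 : R^o) + t - t| by near: h.
  rewrite addrK /GRing.scale /= mulr1 => he.
  rewrite distrC.
  have -> : h^-1 * (g (h + t) - g t) - d = h^-1 * (g (h + t) - g t - h * d).
    by rewrite [RHS]mulrBr mulrA mulVf // mul1r.
  rewrite normrM normfV ler_pdivrMl ?normr_gt0 //.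
  by rewrite [leRHS]mulrC.
apply: DeriveDef.
  by apply/cvg_ex; exists d.
by apply/cvg_lim => //; exact: Rhausdorff.
Unshelve. all: by end_near. Qed.

(** * Proper separation of a point from a convex set *)

Lemma convex_setP (R : realType) (n : nat) (C : set 'cV[R]_n) :
  convex_set C <->
  forall x y s, C x -> C y -> 0 <= s <= 1 -> C (s *: x + (1 - s) *: y).
Proof.
split=> [cC x y s Cx Cy /andP[s0 s1]|cC x y s].
  by have := cC x y (Itv01 s0 s1) (mem_set Cx) (mem_set Cy); rewrite inE.
rewrite !inE => Cx Cy; apply: cC => //.
by apply/andP; split.
Qed.

Lemma convex_functionP (R : realType) (n : nat) (C : set 'cV[R]_n)
    (f : 'cV[R]_n -> R) x y s :
  convex_function C f -> C x -> C y -> 0 <= s <= 1 ->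
  f (s *: x + (1 - s) *: y) <= s * f x + (1 - s) * f y.
Proof.
move=> cf Cx Cy /andP[s0 s1].
exact: (cf (Itv01 s0 s1) _ _ (mem_set Cx) (mem_set Cy)).
Qed.

(** The separating functional is built one coordinate at a time, as in the
    one-dimensional extension step of the Hahn-Banach theorem, because the usual
    nearest-point argument would ask for a closed set.  The induction is on a
    bound [k] beyond which the coordinates vanish on [C].  If the coordinate
    [i0] does not change sign on [C], then it separates, up to sign, unless it
    vanishes identically on [C].  If it takes both signs, the slice [C'] where it vanishes is
    nonempty and is separated by some [q]; the required functional is
    [q + al *: delta_mx i0 0], where each point off the slice bounds [al] on one
    side.  These bounds are compatible because the segment joining two points on
    opposite sides meets the slice, where [q] is nonnegative. *)
Lemma proper_separation0 (R : realType) (n : nat) (C : set 'cV[R]_n) :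
  convex_set C -> C !=set0 -> ~ C 0 ->
  exists p, (forall x, C x -> 0 <= dotv p x) /\ exists2 x, C x & 0 < dotv p x.
Proof.
move=> cC C0 nC0.
suff H k : (forall x, C x -> forall i : 'I_n, (k <= i)%N -> x i 0 = 0) ->
    exists p, (forall x, C x -> 0 <= dotv p x) /\ exists2 x, C x & 0 < dotv p x.
  by apply: (H n) => x _ i; rewrite leqNgt ltn_ord.
elim: k C cC C0 nC0 => [|k IH] C cC C0 nC0 Ck.
  case: C0 => x Cx; case: nC0.
  suff <- : x = 0 by [].
  by apply/colP => i; rewrite mxE; exact: Ck.
have [kn|nk] := ltnP k n; last first.
  by apply: IH => // x _ i ki; have := leq_trans nk ki; rewrite leqNgt ltn_ord.
pose i0 := Ordinal kn.
pose C' := C `&` [set x | x i0 0 = 0].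
have cvx := (convex_setP C).1 cC.
have C'k x : C' x -> forall i : 'I_n, (k <= i)%N -> x i 0 = 0.
  move=> [Cx xi0] i; rewrite leq_eqVlt => /predU1P[ki|]; last exact: Ck.
  by have -> : i = i0 by apply/val_inj; rewrite /= ki.
have cC' : convex_set C'.
  apply/convex_setP => x y s [Cx xi0] [Cy yi0] s01; split; first exact: cvx.
  by rewrite /= !mxE xi0 yi0 !mulr0 addr0.
(* The point where the segment from [y] to [z] crosses the slice. *)
have cross y z : C y -> C z -> 0 < y i0 0 -> z i0 0 < 0 ->
    C' ((y i0 0 - z i0 0)^-1 *: (- z i0 0 *: y + y i0 0 *: z)).
  move=> Cy Cz y0 z0.
  have d0 : 0 < y i0 0 - z i0 0 by lra.
  split; last by rewrite /= !mxE mulNr [y i0 0 * _]mulrC addNr mulr0.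
  rewrite scalerDr !scalerA.
  have -> : (y i0 0 - z i0 0)^-1 * y i0 0 =
      1 - (y i0 0 - z i0 0)^-1 * - z i0 0.
    by field; rewrite gt_eqF.
  apply: cvx => //; rewrite mulrC ler_pdivlMr // ler_pdivrMr //.
  by rewrite mul0r mul1r; apply/andP; split; lra.
have [[y [Cy y0]]|npos] := pselect (exists y, C y /\ 0 < y i0 0); last first.
  have [[z [Cz z0]]|nneg] := pselect (exists z, C z /\ z i0 0 < 0); last first.
    apply: IH => // x Cx; apply: C'k; split => //=.
    by apply/eqP; rewrite eq_le !leNgt; apply/andP; split; apply/negP => ?;
      [apply: npos|apply: nneg]; exists x.
  exists (- delta_mx i0 0); split=> [x Cx|].
    rewrite dotvC dotvNr dotvC dotv_delta oppr_ge0 leNgt; apply/negP => x0.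
    by apply: npos; exists x.
  by exists z => //; rewrite dotvC dotvNr dotvC dotv_delta oppr_gt0.
have [[z [Cz z0]]|nneg] := pselect (exists z, C z /\ z i0 0 < 0); last first.
  exists (delta_mx i0 0); split=> [x Cx|].
    rewrite dotv_delta leNgt; apply/negP => x0.
    by apply: nneg; exists x.
  by exists y => //; rewrite dotv_delta.
have C'0 : C' !=set0 by eexists; exact: (cross y z).
have nC'0 : ~ C' 0 by case.
have [q [q0 [w C'w qw]]] := IH C' cC' C'0 nC'0 C'k.
pose S := [set a | exists2 x, C x /\ 0 < x i0 0 & a = - dotv q x / x i0 0].
have Sub x' : C x' -> x' i0 0 < 0 -> ubound S (dotv q x' / - x' i0 0).
  move=> Cx' x'0 _ [x [Cx x0] ->].
  have := q0 _ (cross x x' Cx Cx' x0 x'0).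
  rewrite dotvZr dotvDr !dotvZr pmulr_rge0 ?invr_gt0; last lra.
  move=> h; rewrite ler_pdivrMr // mulrAC ler_pdivlMr ?oppr_gt0 //; lra.
have S0 : S !=set0 by eexists; exists y; [split; [exact: Cy|exact: y0]|].
pose al := sup S.
have hS : has_sup S by split=> //; eexists; exact: (Sub z).
exists (q + al *: delta_mx i0 0).
have pE x : dotv (q + al *: delta_mx i0 0) x = dotv q x + al * x i0 0.
  by rewrite dotvC dotvDr dotvZr dotvC; congr (_ + _ * _); rewrite dotvC dotv_delta.
split=> [x Cx|]; last first.
  exists w; first by case: C'w.
  have wi0 : w i0 0 = 0 by case: C'w.
  by rewrite pE wi0 mulr0 addr0.
rewrite pE; have [x0|x0|x0] := ltgtP (x i0 0) 0.
- have : al <= dotv q x / - x i0 0 by apply: ge_sup => //; exact: Sub.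
  by rewrite ler_pdivlMr ?oppr_gt0 // => ?; lra.
- have : - dotv q x / x i0 0 <= al.
    by apply: sup_upper_bound => //; exists x.
  by rewrite ler_pdivrMr // => ?; lra.
- by rewrite x0 mulr0 addr0; apply: q0; split.
Qed.

Lemma proper_separation (R : realType) (n : nat) (C : set 'cV[R]_n) a :
  convex_set C -> C !=set0 -> ~ C a ->
  exists p, (forall x, C x -> 0 <= dotv p (x - a)) /\
            exists2 x, C x & 0 < dotv p (x - a).
Proof.
move=> /convex_setP cC [x0 Cx0] nCa.
have [|||p [p0 [w Cw pw]]] := @proper_separation0 _ _ [set x | C (x + a)].
- apply/convex_setP => x y s /= Cx Cy s01.
  suff -> : s *: x + (1 - s) *: y + a = s *: (x + a) + (1 - s) *: (y + a).
    exact: cC.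
  by rewrite !scalerDr addrACA -[s *: a + _]scalerDl [s + _]addrC subrK scale1r addrC.
- by exists (x0 - a); rewrite /= subrK.
- by rewrite /= add0r.
exists p; split=> [x Cx|]; first by apply: p0; rewrite /= subrK.
by exists (w + a); rewrite // addrK.
Qed.

(** Properness can be witnessed by a member of the family: the separation is
    applied to the smallest convex set [C] containing the family, and a
    functional that is nonpositive on the family is nonpositive on [C]. *)
Lemma proper_separation_family (R : realType) (n : nat) (Omega : set 'cV[R]_n)
    (T : Type) (I : set T) (u : T -> 'cV[R]_n) a :
  convex_set Omega -> I !=set0 -> (forall t, I t -> Omega (u t)) -> ~ Omega a ->
  exists p, (forall t, I t -> 0 <= dotv p (u t - a)) /\
            exists2 t, I t & 0 < dotv p (u t - a).
Proof.
move=> cO [t0 It0] uO nOa.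
pose C := [set x | forall E, convex_set E -> (forall t, I t -> E (u t)) -> E x].
have uC t : I t -> C (u t) by move=> It E _; exact.
have [|||p [p0 [w Cw pw]]] := @proper_separation _ _ C a.
- apply/convex_setP => x y s Cx Cy s01 E cE uE.
  by apply: (convex_setP E).1 => //; [exact: Cx | exact: Cy].
- by exists (u t0); exact: uC.
- by move=> Ca; apply: nOa; exact: Ca.
exists p; split=> [t It|]; first by apply: p0; exact: uC.
have [//|nex] := pselect (exists2 t, I t & 0 < dotv p (u t - a)).
exfalso.
suff : dotv p (w - a) <= 0 by rewrite leNgt pw.
apply: (Cw [set x | dotv p (x - a) <= 0]) => [|t It /=].
  apply/convex_setP => x y s /= x0 y0 /andP[s0 s1].
  have -> : s *: x + (1 - s) *: y - a = s *: (x - a) + (1 - s) *: (y - a).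
    rewrite !scalerBr addrACA -opprD -scalerDl.
    by congr (_ - _); rewrite [s + _]addrC subrK scale1r.
  rewrite dotvDr !dotvZr.
  have : s * dotv p (x - a) <= 0 by rewrite mulr_ge0_le0.
  have : (1 - s) * dotv p (y - a) <= 0 by rewrite mulr_ge0_le0 // subr_ge0.
  lra.
by rewrite leNgt; apply/negP => ?; apply: nex; exists t.
Qed.

(** * Calculus on a time interval *)

(** Endpoints only carry continuity, which is exactly what the mean value
    theorem asks for. *)
Definition derivative_on (R : realType) (T : R) (g g' : R -> R) : Prop :=
  {within `[0, T], continuous g} /\
  forall t, t \in `]0, T[ -> is_derive (t : R^o) 1 (g : R^o -> R^o) (g' t).

Lemma derivative_on_eq (R : realType) (T : R) (g g' h' : R -> R) :
  (forall t, t \in `]0, T[ -> g' t = h' t) ->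
  derivative_on T g g' -> derivative_on T g h'.
Proof. by move=> gh [cg dg]; split=> // t tT; rewrite -gh //; exact: dg. Qed.

Lemma derivative_on_cst (R : realType) (T c : R) :
  derivative_on T (fun=> c) (fun=> 0).
Proof.
split; first by apply/subspace_continuousP => t _; exact: cvg_cst.
by move=> t _; exact: is_derive_cst.
Qed.

Lemma derivative_on_id (R : realType) (T : R) : derivative_on T id (fun=> 1).
Proof.
split; first by apply/subspace_continuousP => t _; exact: cvg_within.
by move=> t _; exact: is_derive_id.
Qed.

Lemma derivative_onD (R : realType) (T : R) (g g' h h' : R -> R) :
  derivative_on T g g' -> derivative_on T h h' ->
  derivative_on T (fun t => g t + h t) (fun t => g' t + h' t).
Proof.
move=> [cg dg] [ch dh]; split=> [|t tT].
  apply/subspace_continuousP => t tT; apply: cvgD.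
    by move/subspace_continuousP: cg; exact.
  by move/subspace_continuousP: ch; exact.
exact: (is_deriveD (dg t tT) (dh t tT)).
Qed.

Lemma derivative_onM (R : realType) (T : R) (g g' h h' : R -> R) :
  derivative_on T g g' -> derivative_on T h h' ->
  derivative_on T (fun t => g t * h t) (fun t => g' t * h t + g t * h' t).
Proof.
move=> [cg dg] [ch dh]; split=> [|t tT].
  apply/subspace_continuousP => t tT; apply: cvgM.
    by move/subspace_continuousP: cg; exact.
  by move/subspace_continuousP: ch; exact.
apply: is_derive_eq; first exact: (is_deriveM (dg t tT) (dh t tT)).
by rewrite addrC; congr (_ + _); exact: mulrC.
Qed.

Lemma derivative_onZ (R : realType) (T c : R) (g g' : R -> R) :
  derivative_on T g g' ->
  derivative_on T (fun t => c * g t) (fun t => c * g' t).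
Proof.
move=> dg; have := derivative_onM (derivative_on_cst T c) dg.
by apply: derivative_on_eq => t _; rewrite mul0r add0r.
Qed.

Lemma derivative_onB (R : realType) (T : R) (g g' h h' : R -> R) :
  derivative_on T g g' -> derivative_on T h h' ->
  derivative_on T (fun t => g t - h t) (fun t => g' t - h' t).
Proof.
move=> dg /(derivative_onZ (-1)) dh.
under eq_fun do rewrite -mulN1r.
by have := derivative_onD dg dh; apply: derivative_on_eq => t _; rewrite mulN1r.
Qed.

Lemma derivative_on_sum (R : realType) (T : R) (n : nat) (g g' : 'I_n -> R -> R) :
  (forall i, derivative_on T (g i) (g' i)) ->
  derivative_on T (fun t => \sum_i g i t) (fun t => \sum_i g' i t).
Proof.
move=> dg; elim: (index_enum _) => [|i r IH].
  under eq_fun do rewrite big_nil.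
  by apply: derivative_on_eq (derivative_on_cst T 0) => t _; rewrite big_nil.
under eq_fun do rewrite big_cons.
by apply: derivative_on_eq (derivative_onD (dg i) IH) => t _; rewrite big_cons.
Qed.

Definition curve_derivative_on (R : realType) (n : nat) (T : R)
    (u u' : R -> 'cV[R]_n) : Prop :=
  forall i, derivative_on T (fun t => u t i 0) (fun t => u' t i 0).

Lemma curve_derivative_on_cst (R : realType) (n : nat) (T : R) (p : 'cV[R]_n) :
  curve_derivative_on T (fun=> p) (fun=> 0).
Proof.
move=> i; apply: derivative_on_eq (derivative_on_cst T (p i 0)) => t _.
by rewrite mxE.
Qed.

Lemma curve_derivative_onB (R : realType) (n : nat) (T : R)
    (u u' v v' : R -> 'cV[R]_n) :
  curve_derivative_on T u u' -> curve_derivative_on T v v' ->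
  curve_derivative_on T (fun t => u t - v t) (fun t => u' t - v' t).
Proof.
move=> du dv i.
have -> : (fun t => (u t - v t) i 0) = (fun t => u t i 0 - v t i 0).
  by apply/funext => t; rewrite !mxE.
by apply: derivative_on_eq (derivative_onB (du i) (dv i)) => t _; rewrite !mxE.
Qed.

Lemma derivative_on_dotv (R : realType) (n : nat) (T : R)
    (p p' u u' : R -> 'cV[R]_n) :
  curve_derivative_on T p p' -> curve_derivative_on T u u' ->
  derivative_on T (fun t => dotv (p t) (u t))
    (fun t => dotv (p' t) (u t) + dotv (p t) (u' t)).
Proof.
move=> dp du.
under eq_fun do rewrite dotvE.
apply: derivative_on_eq (derivative_on_sum (fun i => derivative_onM (dp i) (du i))).
by move=> t _; rewrite !dotvE big_split.
Qed.

Lemma derivative_on_le (R : realType) (T : R) (g g' : R -> R) :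
  derivative_on T g g' -> (forall t, t \in `]0, T[ -> g' t <= 0) ->
  forall s t, 0 <= s -> s <= t -> t <= T -> g t <= g s.
Proof.
move=> [cg dg] g'0.
apply: (ler0_derive1_nincr _ _ cg) => // t tT.
  by have [] := dg t tT.
by rewrite derive1E; have [_ ->] := dg t tT; exact: g'0.
Qed.

(** * Time averages of curves *)

Definition displacement (R : realType) (n : nat) (u : R -> 'cV[R]_n) (t : R) :
    'cV[R]_n :=
  \col_i (parameterized_integral lebesgue_measure 0 t (fun s => u s i 0)).

Lemma displacement0 (R : realType) (n : nat) (u : R -> 'cV[R]_n) :
  displacement u 0 = 0.
Proof.
apply/colP => i; rewrite !mxE /parameterized_integral set_itv1.
exact: Rintegral_set1.
Qed.

Lemma displacement_average (R : realType) (n : nat) (u : R -> 'cV[R]_n) (T : R) :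
  0 < T -> displacement u T = T *: time_average u T.
Proof.
move=> T0; apply/colP => i.
by rewrite !mxE /parameterized_integral mulrA mulfV ?gt_eqF // mul1r.
Qed.

Lemma derivative_on_displacement (R : realType) (n : nat) (u : R -> 'cV[R]_n)
    (T : R) : 0 < T ->
  (forall i, {within `[0, T], continuous (fun t => u t i 0)}) ->
  curve_derivative_on T (displacement u) u.
Proof.
move=> T0 cu i.
have int : lebesgue_measure.-integrable `[0, T] (EFin \o (fun s => u s i 0)).
  by apply: continuous_compact_integrable => //; exact: segment_compact.
have -> : (fun t => displacement u t i 0) =
    (fun t => parameterized_integral lebesgue_measure 0 t (fun s => u s i 0)).
  by apply/funext => t; rewrite mxE.
split=> [|t /[dup] tT]; first exact: parameterized_integral_continuous (ltW T0) int.
rewrite in_itv /= => /andP[t0 tltT].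
have [|dF F'] := continuous_FTC1_closed tltT int t0.
  exact: (within_continuous_continuous T0 (cu i)).
by apply: DeriveDef; [exact: dF | rewrite -derive1E].
Qed.

Lemma derivative_on_recentered_displacement (R : realType) (n : nat)
    (u : R -> 'cV[R]_n) (T : R) (p a : 'cV[R]_n) : 0 < T ->
  (forall i, {within `[0, T], continuous (fun t => u t i 0)}) ->
  derivative_on T (fun t => dotv p (displacement u t - t *: a))
    (fun t => dotv p (u t - a)).
Proof.
move=> T0 cu.
have dU := derivative_on_dotv (curve_derivative_on_cst T p)
  (derivative_on_displacement T0 cu).
have dt := derivative_onM (derivative_on_id T) (derivative_on_cst T (dotv p a)).
have -> : (fun t => dotv p (displacement u t - t *: a)) =
    (fun t => dotv p (displacement u t) - t * dotv p a).
  by apply/funext => t; rewrite dotvBr dotvZr.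
apply: derivative_on_eq (derivative_onB dU dt) => t _.
by rewrite dotvBr dot0v add0r mul1r mulr0 addr0.
Qed.

(** As [Omega] need not be closed, it is not enough that the average is a limit
    of convex combinations.  If the average [a] were outside [Omega], some [p]
    would separate it properly from the values of the curve.  Then
    [dotv p (displacement u t - t *: a)] is nondecreasing and vanishes at both
    ends of the interval, so it is constant and its derivative
    [dotv p (u t - a)] is zero throughout, contrary to properness. *)
Lemma time_average_mem (R : realType) (n : nat) (Omega : set 'cV[R]_n)
    (u : R -> 'cV[R]_n) (T : R) : 0 < T -> convex_set Omega ->
  (forall i, {within `[0, T], continuous (fun t => u t i 0)}) ->
  (forall t, t \in `]0, T[ -> Omega (u t)) ->
  Omega (time_average u T).
Proof.
move=> T0 cO cu uO; apply: contrapT => nOa.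
set a := time_average u T in nOa.
have [||p [p0 [t /= tT pt]]] :=
    @proper_separation_family _ _ _ _ [set` `]0, T[] u a cO _ _ nOa.
- exists (T / 2); rewrite /= in_itv /=; apply/andP; split; lra.
- by move=> t /= /uO.
pose g t := dotv p (displacement u t - t *: a).
have dg : derivative_on T g (fun t => dotv p (u t - a)).
  exact: derivative_on_recentered_displacement.
have gle : forall s t, 0 <= s -> s <= t -> t <= T -> g s <= g t.
  move=> s r s0 sr rT; rewrite -lerN2 -[leLHS]mulN1r -[leRHS]mulN1r.
  apply: (derivative_on_le (derivative_onZ (-1) dg)) s0 sr rT => q qT.
  by rewrite mulN1r oppr_le0; exact: p0.
have g0 : g 0 = 0 by rewrite /g displacement0 scale0r subrr dotv0.
have gT : g T = 0.
  by rewrite /g displacement_average // subrr dotv0.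
have gz s : s \in `]0, T[ -> g s = 0.
  rewrite in_itv /= => /andP[s0 sT]; apply/eqP; rewrite eq_le.
  by rewrite -{1}gT -{1}g0 !gle // ltW.
have := dg.2 t tT.
(* [g] vanishes near [t], so its derivative there is 0. *)
have : is_derive (t : R^o) 1 (g : R^o -> R^o) 0.
  have c0 := is_derive_cst (0 : R^o) (t : R^o) 1.
  apply: near_eq_is_derive c0.
  near=> s; rewrite gz //.
  by near: s; exact: (near_in_itvoo tT).
move=> [_ e1] [_ e2]; move: pt; rewrite -e2 e1 ltxx //.
Unshelve. all: by end_near. Qed.

(** * First-order consequences of convexity *)

Lemma cvg_ray (R : realType) (V : normedModType R) (x v : V) :
  (fun s : R => x + s *: v) @ 0^'+ --> x.
Proof.
apply: cvg_at_right_filter.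
have : (fun s : R => x + s *: v) @ 0 --> x + 0 *: v.
  by apply: cvgD; [exact: cvg_cst | apply: cvgZr_tmp; exact: cvg_id].
by rewrite scale0r addr0.
Qed.

Lemma is_diff_within_ray (R : realType) (V W : normedModType R) (D : set V)
    (g : V -> W) (x v : V) (L : V -> W) (e : R) :
  is_diff_within D g x L -> (\forall s \near (0 : R)^'+, D (x + s *: v)) ->
  0 < e ->
  \forall s \near (0 : R)^'+,
    `|g (x + s *: v) - g x - L (s *: v)| <= e * (s * `|v|).
Proof.
move=> gL Dv e0.
have near_x : \forall y \near x, D y -> `|g y - g x - L (y - x)| <= e * `|y - x|
  := gL e e0.
have := cvg_ray v near_x; rewrite /= nbhs_simpl /= => near_s.
near=> s.
have s0 : 0 < s by [].
have Ds : D (x + s *: v) by near: s.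
have : D (x + s *: v) ->
    `|g (x + s *: v) - g x - L (x + s *: v - x)| <= e * `|x + s *: v - x|.
  by near: s.
move=> /(_ Ds); rewrite [x + _]addrC addrK normrZ (gtr0_norm s0).
by [].
Unshelve. all: by end_near. Qed.

(** Convexity bounds the increment of [f] along the segment from [x] to [y] by
    [s * (f y - f x)], and the expansion at [x] identifies its linear part.  The
    segment stays in [Omega], so the expansion relative to [Omega] suffices. *)
Lemma convex_gradient_le (R : realType) (n : nat) (Omega : set 'cV[R]_n)
    (f : 'cV[R]_n -> R) (x y p : 'cV[R]_n) :
  convex_set Omega -> convex_function Omega f -> Omega x -> Omega y ->
  is_diff_within Omega (f : _ -> R^o) x (dotv p : _ -> R^o) ->
  dotv p (y - x) <= f y - f x.
Proof.
move=> /convex_setP cO cf Ox Oy fp.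
have seg s : x + s *: (y - x) = s *: y + (1 - s) *: x.
  by rewrite scalerBr scalerBl scale1r addrCA.
have seg_in : \forall s \near (0 : R)^'+, Omega (x + s *: (y - x)).
  near=> s; rewrite seg; apply: cO => //; apply/andP; split => //.
  by near: s; exact: nbhs_right_le.
apply/ler_addgt0Pr => e e0.
(* The summand 1 keeps the denominator positive when [y = x]. *)
have e'0 : 0 < e / (`|y - x| + 1) by rewrite divr_gt0 // ltr_wpDl.
have ray := is_diff_within_ray fp seg_in e'0.
near (0 : R)^'+ => s.
have s0 : 0 < s by [].
have s1 : s <= 1 by near: s; exact: nbhs_right_le.
have : `|f (x + s *: (y - x)) - f x - dotv p (s *: (y - x))| <=
    e / (`|y - x| + 1) * (s * `|y - x|) by near: s.
rewrite dotvZr seg distrC => /(le_trans (ler_norm _)) h1.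
have h2 : f (s *: y + (1 - s) *: x) <= s * f y + (1 - s) * f x.
  by apply: (convex_functionP cf) => //; apply/andP; split; [exact: ltW|].
have h3 : e / (`|y - x| + 1) * `|y - x| <= e.
  by rewrite mulrAC ler_pdivrMr ?ltr_wpDl // ler_pM2l // lerDl.
have h4 : e / (`|y - x| + 1) * (s * `|y - x|) <= s * e.
  by rewrite mulrCA ler_pM2l.
rewrite -(ler_pM2l s0); lra.
Unshelve. all: by end_near. Qed.

(** Adding the strong convexity inequalities for [(x, y)] and [(y, x)] cancels
    the values of [Phi]. *)
Lemma strongly_convex1_monotone (R : realType) (n : nat) (Omega : set 'cV[R]_n)
    (normw Phi : 'cV[R]_n -> R) (gradPhi : 'cV[R]_n -> 'cV[R]_n) x y :
  is_norm normw -> strongly_convex1 Omega normw Phi gradPhi ->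
  Omega x -> Omega y ->
  normw (x - y) ^+ 2 <= dotv (x - y) (gradPhi x - gradPhi y).
Proof.
move=> [_ hom _] sc Ox Oy.
have nyx : normw (y - x) = normw (x - y).
  by rewrite -opprB -scaleN1r hom normrN1 mul1r.
have := sc x y Ox Oy; have := sc y x Oy Ox; rewrite nyx /bregman.
rewrite -[y - x]opprB; set d := x - y.
rewrite dotvNr dotvBr [dotv d (gradPhi x)]dotvC [dotv d (gradPhi y)]dotvC; lra.
Qed.

Lemma unitmx_injective (R : fieldType) (n : nat) (M : 'M[R]_n) :
  (forall v : 'cV[R]_n, M *m v = 0 -> v = 0) -> M \in unitmx.
Proof.
move=> inj; rewrite -unitmx_tr -row_free_unit; apply: inj_row_free => v vM.
by apply/trmx_inj; rewrite trmx0; apply: inj; rewrite -[M]trmxK -trmx_mul vM trmx0.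
Qed.

(** If [H *m v = 0], the gradient varies by [o(s)] between [x] and [x + s *: v],
    whereas strong monotonicity forces its pairing with [s *: v] to be at least
    [s ^+ 2 * normw v ^+ 2]; letting [s] tend to 0 gives [normw v = 0]. *)
Lemma strongly_convex1_hessian_unit (R : realType) (n : nat)
    (Omega : set 'cV[R]_n) (normw Phi : 'cV[R]_n -> R)
    (gradPhi : 'cV[R]_n -> 'cV[R]_n) (x : 'cV[R]_n) (H : 'M[R]_n) :
  is_norm normw -> strongly_convex1 Omega normw Phi gradPhi -> Omega^° x ->
  is_diff_within Omega gradPhi x (mulmx H) -> H \in unitmx.
Proof.
move=> nw sc Ox gH; apply: unitmx_injective => v Hv.
have Oxx : Omega x by exact: interior_subset.
have ray_in : \forall s \near (0 : R)^'+, Omega (x + s *: v).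
  by have := cvg_ray v Ox; rewrite /= nbhs_simpl.
apply: (is_norm_definite nw); apply/eqP; rewrite -sqrf_eq0 eq_le sqr_ge0 andbT.
apply/ler_addgt0Pr => e e0; rewrite add0r.
(* [K] absorbs the pairing with [v] of an increment of size at most
   [e / K * (s * `|v|)]. *)
pose K : R := (\sum_i `|v i 0|) * `|v| + 1.
have K0 : 0 < K by rewrite ltr_wpDl // mulr_ge0 // sumr_ge0.
have ray := is_diff_within_ray gH ray_in (divr_gt0 e0 K0).
near (0 : R)^'+ => s.
have s0 : 0 < s by [].
have Os : Omega (x + s *: v) by near: s.
have : `|gradPhi (x + s *: v) - gradPhi x - H *m (s *: v)| <=
    e / K * (s * `|v|) by near: s.
rewrite -scalemxAr Hv scaler0 subr0 => g_le.
have := strongly_convex1_monotone nw sc Os Oxx.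
rewrite [x + _]addrC addrK [s *: v + x]addrC dotvC dotvZr dotvC.
rewrite (is_norm_homogeneous nw) (gtr0_norm s0) exprMn expr2 -mulrA ler_pM2l //.
move=> /le_trans mono; rewrite -(ler_pM2l s0); apply: mono.
apply: le_trans (ler_norm _) _; apply: le_trans (dotv_le _ _) _.
apply: le_trans (ler_wpM2l _ g_le) _; first exact: sumr_ge0.
have -> : (\sum_i `|v i 0|) * (e / K * (s * `|v|)) =
    s * (e / K * ((\sum_i `|v i 0|) * `|v|)) by ring.
rewrite ler_pM2l // mulrAC ler_pdivrMr // ler_pM2l // /K lerDl //.
Unshelve. all: by end_near. Qed.

(** * The Bregman divergence along a curve *)

Lemma derivative_on_of_diff (R : realType) (T : R) (g g' : R -> R) :
  (forall t, 0 <= t -> is_diff_within (`[0, +oo[ : set R^o)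
     (g : R^o -> R^o) t (fun h => h * g' t)) ->
  derivative_on T g g'.
Proof.
move=> dg; split=> [|t].
  have sub : `[0, T] `<=` (`[0, +oo[ : set R) by exact: subset_itvl.
  apply: continuous_subspaceW sub _.
  apply/subspace_continuousP => t; rewrite /= in_itv /= andbT => t0.
  exact: (is_diff_within_cvg (dg t t0)).
rewrite in_itv /= => /andP[t0 _].
apply: is_diff_within_is_derive (dg t (ltW t0)).
by rewrite interior_itv /= in_itv /= andbT.
Qed.

Lemma bregman_ge0 (R : realType) (n : nat) (Omega : set 'cV[R]_n)
    (normw Phi : 'cV[R]_n -> R) (gradPhi : 'cV[R]_n -> 'cV[R]_n) x y :
  strongly_convex1 Omega normw Phi gradPhi -> Omega x -> Omega y ->
  0 <= bregman Phi gradPhi x y.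
Proof.
by move=> sc Ox Oy; apply: le_trans (sc x y Ox Oy); rewrite mulr_ge0 ?sqr_ge0.
Qed.

(** The two terms [dotv (gradPhi (u t)) (u' t)], one from [Phi] and one from the
    increment [z - u t], cancel; only the variation of the gradient remains. *)
Lemma derivative_on_bregman (R : realType) (n : nat) (Omega : set 'cV[R]_n)
    (Phi : 'cV[R]_n -> R) (gradPhi : 'cV[R]_n -> 'cV[R]_n)
    (hessPhi : 'cV[R]_n -> 'M[R]_n) (u u' : R -> 'cV[R]_n) (z : 'cV[R]_n) (T : R) :
  is_gradient_on Omega Phi gradPhi -> is_jacobian_on Omega gradPhi hessPhi ->
  (forall t, 0 <= t -> Omega (u t)) ->
  (forall t, 0 <= t -> is_diff_within (`[0, +oo[ : set R^o) (u : R^o -> _) t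
     (fun h : R^o => h *: u' t)) ->
  derivative_on T (fun t => bregman Phi gradPhi z (u t))
    (fun t => - dotv (hessPhi (u t) *m u' t) (z - u t)).
Proof.
move=> gPhi jPhi uO du.
have uO' t : (`[0, +oo[%classic : set R^o) t -> Omega (u t).
  by rewrite /= in_itv /= andbT; exact: uO.
have dPhi : derivative_on T (fun t => Phi (u t)) (fun t => dotv (gradPhi (u t)) (u' t)).
  apply: derivative_on_of_diff => t t0.
  exact: is_diff_within_comp_curve uO' (du t t0) (gPhi _ (uO t t0)).
have dcurve : curve_derivative_on T u u'.
  move=> i; apply: derivative_on_of_diff => t t0 e e0.
  have := is_diff_within_coord i (du t t0) e0; apply: filterS => s.
  by rewrite mxE.
have dgrad : curve_derivative_on T (fun t => gradPhi (u t))
    (fun t => hessPhi (u t) *m u' t).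
  move=> i; apply: derivative_on_of_diff => t t0.
  have rowE v : dotv (row i (hessPhi (u t)))^T v = (hessPhi (u t) *m v) i 0.
    by rewrite dotvE mxE; apply: eq_bigr => j _; rewrite !mxE.
  rewrite -rowE.
  apply: (is_diff_within_comp_curve (f := fun y => gradPhi y i 0) uO' (du t t0)).
  have := is_diff_within_coord i (jPhi _ (uO t t0)).
  by congr is_diff_within; apply/funext => v; rewrite rowE.
apply: derivative_on_eq (derivative_onB
  (derivative_onB (derivative_on_cst T (Phi z)) dPhi)
  (derivative_on_dotv dgrad
     (curve_derivative_onB (curve_derivative_on_cst T z) dcurve))) => t _.
by rewrite /= [dotv _ (0 - _)]dotvBr dotv0; ring.
Qed.

(** * Convergence of the time average *)

Theorem theorem1 (R : realType) (m n : nat)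
    (Omega : set 'cV[R]_n) (A : 'M[R]_(m, n)) (b : 'cV[R]_m)
    (f : 'cV[R]_n -> R) (gradf : 'cV[R]_n -> 'cV[R]_n)
    (normw : 'cV[R]_n -> R)
    (Phi : 'cV[R]_n -> R) (gradPhi : 'cV[R]_n -> 'cV[R]_n)
    (hessPhi : 'cV[R]_n -> 'M[R]_n)
    (ustar u0 : 'cV[R]_n) (u : R -> 'cV[R]_n) (c : 'cV[R]_n -> 'cV[R]_m) :
  convex_set Omega ->
  convex_function Omega f ->
  is_gradient_on Omega f gradf ->
  argmin (feasible Omega A b) f = [set ustar] ->
  is_norm normw ->
  is_gradient_on Omega Phi gradPhi ->
  is_jacobian_on Omega gradPhi hessPhi ->
  strongly_convex1 Omega normw Phi gradPhi ->
  feasible Omega A b u0 ->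
  constrained_gradient_flow Omega gradf hessPhi A b c u0 u ->
  (* the inverse Hessian in the flow exists; at interior points of Omega this
     already follows from strong convexity *)
  (forall t : R, 0 <= t -> ~ Omega^° (u t) -> hessPhi (u t) \in unitmx) ->
  forall T : R, 0 < T ->
    f (time_average u T) - f ustar <= T^-1 * bregman Phi gradPhi ustar u0.
Proof.
move=> cO cf gf us nw gPhi jPhi sc _ [u_0 uO du uA] Hunit T T0.
have [[Ostar Astar] _] : argmin (feasible Omega A b) f ustar by rewrite us.
pose a := time_average u T.
pose u' t := - (invmx (hessPhi (u t)) *m (gradf (u t) + A^T *m c (u t))).
have H_unit t : 0 <= t -> hessPhi (u t) \in unitmx.
  move=> t0; have [Oi|nOi] := pselect (Omega^° (u t)); last exact: Hunit.
  exact: strongly_convex1_hessian_unit nw sc Oi (jPhi _ (uO t t0)).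
have uc i : {within `[0, T], continuous (fun t => u t i 0)}.
  suff [] : derivative_on T (fun t => u t i 0) (fun t => u' t i 0) by [].
  apply: derivative_on_of_diff => t t0 e e0.
  have := is_diff_within_coord i (du t t0) e0; apply: filterS => s.
  by rewrite !mxE.
have Oa : Omega a.
  apply: time_average_mem => // t; rewrite in_itv /= => /andP[/ltW t0 _].
  exact: uO.
(* The linear term [dotv (gradf a) (u t - a)] has zero mean, so adding its
   antiderivative to [W] does not change the values at the endpoints. *)
pose gap := f a - f ustar.
pose W t := bregman Phi gradPhi ustar (u t) + gap * t
  + dotv (gradf a) (displacement u t - t *: a).
have dW : derivative_on T W (fun t =>
    - dotv (hessPhi (u t) *m u' t) (ustar - u t) + gap * 1
    + dotv (gradf a) (u t - a)).
  apply: derivative_onD; last exact: derivative_on_recentered_displacement.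
  apply: derivative_onD; last exact: derivative_onZ (derivative_on_id T).
  exact: derivative_on_bregman gPhi jPhi uO du.
have W_le : W T <= W 0.
  apply: (derivative_on_le dW) => // [t|]; last exact: ltW.
  rewrite in_itv /= => /andP[/ltW t0 _].
  rewrite /u' mulmxN mulKVmx ?H_unit // mulr1.
  rewrite [dotv (- _) _]dotvC dotvNr opprK dotvC.
  rewrite [dotv (gradf _ + _) _]dotvC dotvDr [dotv _ (gradf _)]dotvC.
  rewrite [dotv _ (A^T *m _)]dotvC dotv_mulmx mulmxBr Astar uA // subrr dotv0.
  (* What remains is the first-order inequality for [f] at [u t] towards [ustar],
     and at [a] towards [u t]. *)
  have := convex_gradient_le cO cf (uO t t0) Ostar (gf _ (uO t t0)).
  have := convex_gradient_le cO cf Oa (uO t t0) (gf _ Oa).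
  rewrite /gap; lra.
have W0E : W 0 = bregman Phi gradPhi ustar u0.
  by rewrite /W displacement0 scale0r subrr dotv0 mulr0 !addr0 u_0.
have WTE : W T = bregman Phi gradPhi ustar (u T) + gap * T.
  by rewrite /W displacement_average // subrr dotv0 addr0.
have := bregman_ge0 sc Ostar (uO T (ltW T0)).
rewrite ler_pdivlMl // mulrC -/a -/gap; move: W_le; rewrite W0E WTE; lra.
Qed.
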